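(* Let $n\ge 1$, $m=2n+1$, $\rho>0$, and let $d_1,\dots,d_m\in\mathbb{R}^n$, $\theta=(\theta_1,\dots,\theta_m)^\top\in\mathbb{R}^m$ and $F=(F_1,\dots,F_m)^\top\in\mathbb{R}^m$ be the spatial displacements, temporal offsets and observed values of an active sample set. Let $A\in\mathbb{R}^{m\times m}$ have entries $A_{ij}=\tfrac12(d_i^\top d_j)^2$, let $K:=A+\tfrac1\rho I_m$, let $D\in\mathbb{R}^{m\times n}$ be the matrix with rows $d_i^\top$, and let $X_{\mathrm{aug}}:=[\mathbf 1_m\;\;D\;\;\theta]\in\mathbb{R}^{m\times(n+2)}$. Then: (i) $K$ is symmetric and strictly positive definite. (ii) If $\operatorname{rank}(X_{\mathrm{aug}})=n+2$, then $S:=X_{\mathrm{aug}}^\top K^{-1}X_{\mathrm{aug}}\in\mathbb{R}^{(n+2)\times(n+2)}$ is symmetric and strictly positive definite. (iii) If $\operatorname{rank}(X_{\mathrm{aug}})=n+2$, then the matrix $$M=\begin{bmatrix} K & X_{\mathrm{aug}} \\ X_{\mathrm{aug}}^\top & 0 \end{bmatrix}$$ is nonsingular, and the unique solution $(\lambda,c,g,\gamma)\in\mathbb{R}^m\times\mathbb{R}\times\mathbb{R}^n\times\mathbb{R}$ of the linear system $$M\begin{bmatrix} \lambda \\ c \\ g \\ \gamma \end{bmatrix}=\begin{bmatrix} F \\ 0 \\ 0 \\ 0 \end{bmatrix}$$ is given by $$\begin{bmatrix} c \\ g \\ \gamma \end{bmatrix}=S^{-1}X_{\mathrm{aug}}^\top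 K^{-1}F=:\Pi F,\qquad \lambda=K^{-1}\bigl(F-X_{\mathrm{aug}}\Pi F\bigr),$$ where $\Pi:=S^{-1}X_{\mathrm{aug}}^\top K^{-1}\in\mathbb{R}^{(n+2)\times m}$.
   Context: An active set consists of $m=2n+1$ time-stamped samples $(x_i,t_i,F_i)$ with $x_i\in\mathbb{R}^n$, one of which is the center $x_k$ with timestamp $t_k$; $d_i=x_i-x_k$ and $\theta_i=t_i-t_k$. $\mathbf 1_m$ is the all-ones vector in $\mathbb{R}^m$. The linear system in (iii) is the KKT system of the model-fitting problem of minimizing $\tfrac14\|G\|_F^2+\tfrac\rho2\sum_i(Q(x_i,t_i)-F_i)^2$ over models $Q(x,t)=c+g^\top(x-x_k)+\tfrac12(x-x_k)^\top G(x-x_k)+\gamma(t-t_k)$ with $G=G^\top$. *)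

(* Defs.v *)
From mathcomp Require Import all_boot all_order all_algebra.
From mathcomp Require Import reals.

Set Implicit Arguments.
Unset Strict Implicit.
Unset Printing Implicit Defensive.

Import Order.TTheory GRing.Theory Num.Theory.
Local Open Scope ring_scope.

Definition nsamples (n : nat) : nat := (2 * n).+1.

Record active_set (R : realType) (n : nat) := ActiveSet {
  sample_point : 'I_(nsamples n) -> 'cV[R]_n;
  sample_time : 'I_(nsamples n) -> R;
  sample_value : 'I_(nsamples n) -> R;
  center : 'I_(nsamples n)
}.

(* Symmetry is not part of this predicate; it is stated separately. *)
Definition posdefmx (R : realType) (p : nat) (B : 'M[R]_p) : Prop :=
  forall v : 'cV[R]_p, v != 0 -> 0 < (v^T *m B *m v) 0 0.

Section Model.
Variables (R : realType) (n : nat) (a : active_set R n).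
Local Notation m := (nsamples n).

Definition displacement (i : 'I_m) : 'cV[R]_n :=
  sample_point a i - sample_point a (center a).

Definition time_offset : 'cV[R]_m :=
  \col_i (sample_time a i - sample_time a (center a)).

Definition values : 'cV[R]_m := \col_i sample_value a i.

Definition Amx : 'M[R]_m :=
  \matrix_(i, j) (2^-1 * (((displacement i)^T *m displacement j) 0 0) ^+ 2).

Definition Kmx (rho : R) : 'M[R]_m := Amx + (rho^-1)%:M.

Definition Dmx : 'M[R]_(m, n) := \matrix_(i < m) (displacement i)^T.

(* The n + 2 columns are grouped as 1 + (n + 1), following the blocks
   (constant, linear, time). *)
Definition Xaug : 'M[R]_(m, 1 + (n + 1)) :=
  row_mx (const_mx 1) (row_mx Dmx time_offset).

Definition Smx (rho : R) : 'M[R]_(1 + (n + 1)) :=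
  Xaug^T *m invmx (Kmx rho) *m Xaug.

Definition Pimx (rho : R) : 'M[R]_(1 + (n + 1), m) :=
  invmx (Smx rho) *m Xaug^T *m invmx (Kmx rho).

Definition KKTmx (rho : R) : 'M[R]_(m + (1 + (n + 1))) :=
  block_mx (Kmx rho) Xaug Xaug^T 0.

End Model.

Definition coefs (R : realType) (n : nat) (c : R) (g : 'cV[R]_n) (gamma : R)
    : 'cV[R]_(1 + (n + 1)) :=
  col_mx c%:M (col_mx g gamma%:M).

(* Main.v *)
(* The matrix [A] is half the Gram matrix of the vectorized outer products
   [d_i d_i^T], so it is positive semidefinite, and [K] is positive definite
   because of the ridge [1 / rho].  Hence [K^-1] is positive definite too, and so
   is [S], its congruence by an injective matrix.  Block elimination of [lambda]
   then solves the saddle-point system; nonsingularity of [M] is the case of a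
   zero right-hand side. *)

Require Import Defs.
From mathcomp Require Import all_boot all_order all_algebra.
From mathcomp Require Import reals.

Set Implicit Arguments.
Unset Strict Implicit.
Unset Printing Implicit Defensive.

Import Order.TTheory GRing.Theory Num.Theory.
Local Open Scope ring_scope.

Lemma symmetricmxE (F : fieldType) (p : nat) (B : 'M[F]_p) :
  (B \is symmetricmx) = (B == B^T).
Proof. by rewrite is_hermitianmxE expr0 scale1r map_mx_id. Qed.

Lemma sqnormE (R : realType) (p : nat) (v : 'cV[R]_p) :
  (v^T *m v) 0 0 = \sum_i v i 0 ^+ 2.
Proof. by rewrite mxE; apply: eq_bigr => i _; rewrite mxE expr2. Qed.

Lemma sqnorm_ge0 (R : realType) (p : nat) (v : 'cV[R]_p) : 0 <= (v^T *m v) 0 0.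
Proof. by rewrite sqnormE; apply: sumr_ge0 => i _; apply: sqr_ge0. Qed.

Lemma sqnorm_gt0 (R : realType) (p : nat) (v : 'cV[R]_p) :
  v != 0 -> 0 < (v^T *m v) 0 0.
Proof.
move=> v_neq0; rewrite lt_def sqnorm_ge0 andbT sqnormE.
apply: contra v_neq0; rewrite psumr_eq0 => [/allP v0|i _]; last exact: sqr_ge0.
apply/eqP/colP => i; apply/eqP.
by move: (v0 i (mem_index_enum i)); rewrite sqrf_eq0 mxE.
Qed.

Lemma inj_unitmx (F : fieldType) (p : nat) (B : 'M[F]_p) :
  (forall v : 'cV_p, B *m v = 0 -> v = 0) -> B \in unitmx.
Proof.
move=> injB; rewrite -unitmx_tr -row_free_unit; apply: inj_row_free => v.
move=> /(congr1 trmx); rewrite trmx_mul trmxK trmx0 => /injB v0.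
by rewrite -[v]trmxK v0 trmx0.
Qed.

Lemma posdefmx_unit (R : realType) (p : nat) (B : 'M[R]_p) :
  posdefmx B -> B \in unitmx.
Proof.
move=> posB; apply: inj_unitmx => v Bv0; apply/eqP/contraT => /posB.
by rewrite -mulmxA Bv0 mulmx0 mxE ltxx.
Qed.

(** With [w = B^-1 v], symmetry of [B] turns [w^T B w] into [v^T B^-1 v], and [w] is nonzero because
    [B w = v]. *)
Lemma posdefmx_inv (R : realType) (p : nat) (B : 'M[R]_p) :
  B \is symmetricmx -> posdefmx B -> posdefmx (invmx B).
Proof.
rewrite symmetricmxE => /eqP symB posB v v_neq0.
have uB := posdefmx_unit posB.
have Bw : B *m (invmx B *m v) = v by rewrite mulKVmx.
have w_neq0 : invmx B *m v != 0.
  by apply: contra_neq v_neq0 => w0; rewrite -Bw w0 mulmx0.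
by have := posB _ w_neq0; rewrite -mulmxA Bw trmx_mul trmx_inv -symB.
Qed.

Lemma posdefmx_congr (R : realType) (p q : nat) (B : 'M[R]_p) (X : 'M[R]_(p, q)) :
  posdefmx B -> \rank X = q -> posdefmx (X^T *m B *m X).
Proof.
move=> posB rkX v v_neq0.
(* Full column rank makes [X] injective on columns; this is read off as row freeness of the
   transpose. *)
have freeX : row_free X^T by rewrite /row_free mxrank_tr rkX.
have Xv_neq0 : X *m v != 0.
  by rewrite -trmx_eq0 trmx_mul mulmx_free_eq0 // trmx_eq0.
by have := posB _ Xv_neq0; rewrite trmx_mul !mulmxA.
Qed.

Section SaddlePoint.
Variables (F : fieldType) (p q : nat) (K : 'M[F]_p) (X : 'M[F]_(p, q)).
Hypothesis K_unit : K \in unitmx.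
Let S := X^T *m invmx K *m X.
Hypothesis S_unit : S \in unitmx.
Let M := block_mx K X X^T 0.

(** The first block row gives [l] in terms of [z]; substituted into the second, [X^T l = 0], it
    leaves [S z = X^T K^-1 f]. The equivalence yields existence and uniqueness at once. *)
Lemma saddle_solution (f l : 'cV[F]_p) (z : 'cV[F]_q) :
  M *m col_mx l z = col_mx f 0 <->
  z = invmx S *m X^T *m invmx K *m f /\ l = invmx K *m (f - X *m z).
Proof.
rewrite mul_block_col mul0mx addr0; split=> [/eq_col_mx[Ef E0]|[Ez El]].
  have El : l = invmx K *m (f - X *m z) by rewrite -Ef addrK mulKmx.
  split=> //; move: E0; rewrite El !mulmxBr => /eqP; rewrite subr_eq0 => /eqP E.
  by rewrite -!mulmxA E !mulmxA -/S -(mulmxA (invmx S))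
    -(mulmxA (invmx S)) mulVmx // mul1mx.
have SzE : S *m z = X^T *m invmx K *m f by rewrite Ez !mulmxA mulmxV // mul1mx.
by rewrite El mulKVmx // subrK !mulmxA mulmxBr mulmxA -SzE subrr.
Qed.

Lemma saddle_unit : M \in unitmx.
Proof.
apply: inj_unitmx => v; rewrite -[v]vsubmxK => Mv0.
have [-> ->] := (saddle_solution 0 _ _).1 (etrans Mv0 (esym (col_mx0 _ _ _ _))).
by rewrite !mulmx0 subrr mulmx0 col_mx0.
Qed.

End SaddlePoint.

Section Interpolation.
Variables (R : realType) (n : nat) (a : active_set R n).

Definition outer_products : 'M[R]_(nsamples n, n * n) :=
  \matrix_i mxvec (displacement a i *m (displacement a i)^T).

(* The kernel [(d_i^T d_j)^2] is the Frobenius inner product of the feature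
   matrices [d_i d_i^T] and [d_j d_j^T]. *)
Lemma Amx_gram : Amx a = 2^-1 *: (outer_products *m outer_products^T).
Proof.
apply/matrixP => i j; rewrite !mxE; congr (_ * _).
set di := displacement a i; set dj := displacement a j.
have -> : \sum_k outer_products i k * outer_products^T k j
    = (mxvec (di *m di^T) *m (mxvec (dj *m dj^T))^T) 0 0.
  by rewrite mxE; apply: eq_bigr => k _; rewrite !mxE.
(* The inner product becomes the quadratic form of [dj dj^T] at [di], which regroups as
   [(di^T dj) (dj^T di)]. *)
have := mxvec_dotmul (dj *m dj^T) di^T di^T; rewrite trmxK => ->.
rewrite mulmxA -mulmxA.
(* A 1 x 1 matrix equals its transpose. *)
have -> : dj^T *m di = di^T *m dj.
  by rewrite [RHS]mx11_scalar -tr_scalar_mx -mx11_scalar trmx_mul trmxK.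
by rewrite [di^T *m dj]mx11_scalar -scalar_mxM !mxE eqxx.
Qed.

Lemma Kmx_sym (rho : R) : Kmx a rho \is symmetricmx.
Proof.
rewrite symmetricmxE /Kmx Amx_gram linearD linearZ /= trmx_mul trmxK.
by rewrite tr_scalar_mx.
Qed.

Lemma Kmx_posdef (rho : R) : 0 < rho -> posdefmx (Kmx a rho).
Proof.
move=> rho_gt0 v v_neq0.
(* With [P = outer_products], the form splits as half the squared norm of [P^T v], which may vanish,
   plus the ridge term, which is positive. *)
have -> : v^T *m Kmx a rho *m v = 2^-1 *: ((outer_products^T *m v)^T
    *m (outer_products^T *m v)) + rho^-1 *: (v^T *m v).
  rewrite /Kmx Amx_gram mulmxDr mulmxDl mul_mx_scalar -scalemxAr -!scalemxAl.
  by rewrite trmx_mul trmxK !mulmxA.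
rewrite mxE [X in X + _]mxE [X in _ + X]mxE ltr_wpDl //.
  by rewrite mulr_ge0 ?invr_ge0 ?sqnorm_ge0.
by rewrite mulr_gt0 ?invr_gt0 ?sqnorm_gt0.
Qed.

End Interpolation.

Theorem proposition3p2 (R : realType) (n : nat) (a : active_set R n) (rho : R)
    (n_ge1 : (1 <= n)%N) (rho_gt0 : 0 < rho) :
  [/\ (Kmx a rho \is symmetricmx) /\ posdefmx (Kmx a rho),
      \rank (Xaug a) = n.+2 ->
        (Smx a rho \is symmetricmx) /\ posdefmx (Smx a rho)
    & \rank (Xaug a) = n.+2 ->
        KKTmx a rho \in unitmx /\
        forall (lambda : 'cV[R]_(nsamples n)) (c : R) (g : 'cV[R]_n) (gamma : R),
          KKTmx a rho *m col_mx lambda (coefs c g gamma) = col_mx (values a) 0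
          <->
          coefs c g gamma = Pimx a rho *m values a /\
          lambda = invmx (Kmx a rho) *m
                     (values a - Xaug a *m (Pimx a rho *m values a))].

Proof.
have K_sym := Kmx_sym a rho; have K_pos := Kmx_posdef a rho_gt0.
have S_pos : \rank (Xaug a) = n.+2 -> posdefmx (Smx a rho).
  (* [addn1] reconciles the rank [n.+2] with the column count [1 + (n + 1)]. *)
  by move=> rkX; apply: posdefmx_congr (posdefmx_inv _ _) _; rewrite // rkX addn1.
have K_unit := posdefmx_unit K_pos.
split=> // [rkX|/S_pos /posdefmx_unit S_unit].
  split; last exact: S_pos.
  move: K_sym; rewrite !symmetricmxE => /eqP K_sym.
  by rewrite /Smx !trmx_mul trmx_inv trmxK -K_sym mulmxA.
split=> [|lambda c g gamma]; first exact: saddle_unit.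
rewrite /KKTmx saddle_solution // /Pimx -/(Smx a rho).
(* The two sides differ only in whether [lambda] is written through the coefficients or through
   [Pimx a rho *m values a]. *)
by split=> -[-> ->].
Qed.
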